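(* Let $R$ be a domain with the $D$-property. Suppose that for every $b\in R$, the condition $RbR=R$ implies that $b$ is a finite element. Then every $a\in R\setminus\{0\}$ can be written as $a=\alpha f=\varphi\alpha$, where $\alpha\in R$ is a duo element and $f,\varphi\in R$ are finite elements.
   Context: Rings are associative (not necessarily commutative) with $1\neq 0$; domains need not be commutative. $R$ has the $D$-property if for each $a\in R$ there is $a_*\in R$ with $RaR=a_*R=Ra_*$. A nonzero element $a\in R$ is duo if $aR$ and $Ra$ are two-sided ideals and $aR=Ra$. An element $a\in R\setminus\{0\}$ is finite if each right ideal and each left ideal of $R$ that contains $a$ is principal. *)

(* Defs.v *)
From mathcomp Require Import all_boot all_algebra.
From mathcomp Require Import boolp classical_sets.

Set Implicit Arguments.
Unset Strict Implicit.
Unset Printing Implicit Defensive.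

Import GRing.Theory.
Local Open Scope classical_set_scope.
Local Open Scope ring_scope.

(* Ideals are arbitrary subsets [set R], not decidable predicates, and are     *)
(* not required to be proper, unlike those of ring_quotient.                   *)

Definition right_ideal (R : nzRingType) (I : set R) : Prop :=
  [/\ I 0, (forall x y, I x -> I y -> I (x - y))
    & (forall x r, I x -> I (x * r))].

Definition left_ideal (R : nzRingType) (I : set R) : Prop :=
  [/\ I 0, (forall x y, I x -> I y -> I (x - y))
    & (forall x r, I x -> I (r * x))].

Definition two_sided_ideal (R : nzRingType) (I : set R) : Prop :=
  right_ideal I /\ left_ideal I.

Definition right_principal (R : nzRingType) (a : R) : set R :=
  [set a * r | r in [set: R]].

Definition left_principal (R : nzRingType) (a : R) : set R :=
  [set r * a | r in [set: R]].

(* RaR is the generated ideal (finite sums), not the bare set of products. *)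
Definition two_sided_principal (R : nzRingType) (a : R) : set R :=
  [set z | exists s : seq (R * R), z = \sum_(p <- s) p.1 * a * p.2].

Definition D_property (R : nzRingType) : Prop :=
  forall a : R, exists a_s : R,
    two_sided_principal a = right_principal a_s /\
    two_sided_principal a = left_principal a_s.

Definition duo_element (R : nzRingType) (a : R) : Prop :=
  [/\ a != 0, two_sided_ideal (right_principal a),
      two_sided_ideal (left_principal a)
    & right_principal a = left_principal a].

Definition finite_element (R : nzRingType) (a : R) : Prop :=
  [/\ a != 0,
      (forall I : set R, right_ideal I -> I a ->
         exists c : R, I = right_principal c)
    & (forall I : set R, left_ideal I -> I a ->
         exists c : R, I = left_principal c)].

(* Main.v *)
Require Import Defs.
From mathcomp Require Import all_boot all_algebra.
From mathcomp Require Import boolp classical_sets.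
Local Open Scope classical_set_scope.
Local Open Scope ring_scope.

Import GRing.Theory.

(** Let [alpha] be the element that the D-property provides for [a], so that
    [RaR = alpha R = R alpha].  Since [a] lies in [RaR], it factors as
    [a = alpha f = phi alpha].  Conversely [alpha] lies in [RaR], say
    [alpha = sum_i u_i a v_i = sum_i u_i alpha f v_i]; as
    [R alpha = alpha R], each [u_i alpha] is some [alpha u'_i], whence
    [alpha = alpha (sum_i u'_i f v_i)].  Cancelling [alpha] in the domain [R]
    gives [1] in [RfR], so [RfR = R] and [f] is finite by hypothesis; [phi] is
    treated symmetrically. *)

Lemma mem_two_sided_principal (R : nzRingType) (a : R) :
  two_sided_principal a a.
Proof. by exists [:: (1, 1)]; rewrite big_seq1 mul1r mulr1. Qed.

Lemma two_sided_principal_setT (R : nzRingType) (b : R) :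
  two_sided_principal b 1 -> two_sided_principal b = [set: R].
Proof.
case=> s one_s; apply/seteqP; split=> // z _.
exists [seq (z * p.1, p.2) | p <- s].
rewrite big_map -[LHS]mulr1 one_s big_distrr /=.
by apply: eq_bigr => p _; rewrite !mulrA.
Qed.

(** If [R alpha] is contained in [alpha R], then [alpha] can be moved to the
    left out of [R (alpha f) R]. *)
Lemma two_sided_principal_factorl (R : nzRingType) (alpha f z : R) :
  left_principal alpha `<=` right_principal alpha ->
  two_sided_principal (alpha * f) z ->
  exists2 t, two_sided_principal f t & z = alpha * t.
Proof.
move=> Ralpha [s ->].
elim: s => [|[u v] s [_ [s' ->] IHs]].
  by exists 0; [exists [::] | ]; rewrite !big_nil ?mulr0.
have [u' _ u'E] : right_principal alpha (u * alpha) by apply: Ralpha; exists u.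
exists (\sum_(p <- (u', v) :: s') p.1 * f * p.2); first by exists ((u', v) :: s').
by rewrite !big_cons /= mulrDr IHs !mulrA u'E.
Qed.

Lemma two_sided_principal_factorr (R : nzRingType) (alpha f z : R) :
  right_principal alpha `<=` left_principal alpha ->
  two_sided_principal (f * alpha) z ->
  exists2 t, two_sided_principal f t & z = t * alpha.
Proof.
move=> alphaR [s ->].
elim: s => [|[u v] s [_ [s' ->] IHs]].
  by exists 0; [exists [::] | ]; rewrite !big_nil ?mul0r.
have [v' _ v'E] : left_principal alpha (alpha * v) by apply: alphaR; exists v.
exists (\sum_(p <- (u, v') :: s') p.1 * f * p.2); first by exists ((u, v') :: s').
by rewrite !big_cons /= mulrDl IHs -!mulrA v'E.
Qed.

Lemma duo_elementP (R : nzRingType) (a : R) :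
  a != 0 -> right_principal a = left_principal a -> duo_element a.
Proof.
move=> a0 aRE.
have rI : right_ideal (right_principal a).
  split; first by exists 0; rewrite ?mulr0.
    by move=> _ _ [x _ <-] [y _ <-]; exists (x - y); rewrite ?mulrBr.
  by move=> _ r [x _ <-]; exists (x * r); rewrite ?mulrA.
have lI : left_ideal (left_principal a).
  split; first by exists 0; rewrite ?mul0r.
    by move=> _ _ [x _ <-] [y _ <-]; exists (x - y); rewrite ?mulrBl.
  by move=> _ r [x _ <-]; exists (r * x); rewrite ?mulrA.
by split; rewrite // /two_sided_ideal; split; rewrite // ?aRE // -aRE.
Qed.

Theorem theorem2p11 (R : nzRingType)
    (R_domain : GRing.integral_domain_axiom R)
    (R_D : D_property R)
    (R_finite : forall b : R,
       two_sided_principal b = [set: R] -> finite_element b) :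
  forall a : R, a != 0 ->
    exists alpha f phi : R,
      [/\ duo_element alpha, finite_element f, finite_element phi,
          a = alpha * f & a = phi * alpha].
Proof.
move=> a a0; have [alpha [RaR_r RaR_l]] := R_D a.
have rlE : right_principal alpha = left_principal alpha.
  by rewrite -RaR_r -RaR_l.
have [f _ fE] : right_principal alpha a.
  by rewrite -RaR_r; exact: mem_two_sided_principal.
have [phi _ phiE] : left_principal alpha a.
  by rewrite -RaR_l; exact: mem_two_sided_principal.
have alpha0 : alpha != 0.
  by apply: contra_neq a0 => alpha0; rewrite -fE alpha0 mul0r.
have RaR_alpha : two_sided_principal a alpha.
  by rewrite RaR_r; exists 1; rewrite ?mulr1.
exists alpha, f, phi; split=> //; first exact: duo_elementP.
- apply/R_finite/two_sided_principal_setT.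
  have [||t ft alphaE] := @two_sided_principal_factorl R alpha f alpha.
  + by rewrite rlE.
  + by rewrite fE.
  suff -> : 1 = t by [].
  have /R_domain : alpha * (1 - t) = 0 by rewrite mulrBr mulr1 -alphaE subrr.
  by rewrite (negPf alpha0) subr_eq0 => /eqP.
- apply/R_finite/two_sided_principal_setT.
  have [||t phit alphaE] := @two_sided_principal_factorr R alpha phi alpha.
  + by rewrite rlE.
  + by rewrite phiE.
  suff -> : 1 = t by [].
  have /R_domain : (1 - t) * alpha = 0 by rewrite mulrBl mul1r -alphaE subrr.
  by rewrite (negPf alpha0) orbF subr_eq0 => /eqP.
Qed.
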